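(* Consider the loss minimization problem $$\min_{\hat c\in\mathbb R^n\setminus\{0\},\,\hat x}\ \sum_{i\in\mathcal I}\sum_{j\in\mathcal J_i}\lVert x_{ij}-\hat x_i\rVert\quad\text{subject to}\quad \hat x_i\in\Big(\arg\min_{\tilde x\in\mathbb R^n}\{\hat c^{\top}\tilde x: A_i\tilde x\le b_i\}\Big)\cap\mathcal V_i\quad\forall i\in\mathcal I,$$ let $\widehat{\mathcal C}'$ be the set of all $\hat c$ for which some $(\hat c,\hat x)$ is optimal in this problem, and let $\widehat{\mathcal C}:=\widehat{\mathcal C}'\cup\{0\}$. Suppose there is a unique optimal $\hat x$ to this problem, i.e. exactly one $\hat x=(\hat x_i)_{i\in\mathcal I}$ occurs as the $\hat x$-component of an optimal solution $(\hat c,\hat x)$. Then for every $\bar c\in\mathbb R^n$ the problem $$\min_{\hat c}\ \lVert\bar c-\hat c\rVert_2^2\quad\text{subject to}\quad \hat c\in\widehat{\mathcal C}$$ has a unique optimal solution.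
   Context: $n\ge 1$. $\mathcal I$ is a finite set of experiments; experiment $i$ has inputs $A_i\in\mathbb R^{m\times n}$, $b_i\in\mathbb R^m$ such that the polyhedron $\{\tilde x\in\mathbb R^n: A_i\tilde x\le b_i\}$ is compact and nonempty; $\mathcal V_i$ denotes its set of extreme points. For each $i$, $\mathcal J_i$ is a finite set of noisy observations with observed points $x_{ij}\in\mathbb R^n$. $\lVert\cdot\rVert$ is a fixed norm on $\mathbb R^n$. The vector $\bar c$ is called the reference cost vector. *)

(* Defs.v *)
From HB Require Import structures.
From mathcomp Require Import all_boot all_order all_algebra.
From mathcomp Require Import all_classical all_reals all_analysis.

Set Implicit Arguments.
Unset Strict Implicit.
Unset Printing Implicit Defensive.

Import Order.TTheory GRing.Theory Num.Theory.
Import numFieldNormedType.Exports.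

Local Open Scope classical_set_scope.
Local Open Scope ring_scope.

(* The library bundles a norm with its carrier type and already equips         *)
(* 'cV[R]_n with the sup norm, so an arbitrary norm is a function here.        *)
Record is_norm (R : realType) (n : nat) (N : 'cV[R]_n -> R) : Prop := IsNorm {
  is_norm_triangle : forall u v, N (u + v) <= N u + N v;
  is_norm_homogeneous : forall a u, N (a *: u) = `|a| * N u;
  is_norm_definite : forall u, N u = 0 -> u = 0 }.

Definition sqnorm2 (R : realType) (n : nat) (v : 'cV[R]_n) : R :=
  \sum_k (v k 0) ^+ 2.

Definition dot (R : realType) (n : nat) (u v : 'cV[R]_n) : R :=
  (u^T *m v) 0 0.

Definition argmin (R : realType) (T : Type) (f : T -> R) (S : set T) : set T :=
  [set x | S x /\ forall y, S y -> f x <= f y].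

Definition polyhedron (R : realType) (m n : nat)
    (A : 'M[R]_(m, n)) (b : 'cV[R]_m) : set 'cV[R]_n :=
  [set x | forall k, (A *m x) k 0 <= b k 0].

Definition extreme_points (R : realType) (n : nat) (S : set 'cV[R]_n) :
    set 'cV[R]_n :=
  [set x | S x /\ forall y z (t : R), S y -> S z -> 0 < t < 1 ->
                    x = t *: y + (1 - t) *: z -> y = z].

Definition feasible (R : realType) (m n : nat) (I : finType)
    (A : I -> 'M[R]_(m, n)) (b : I -> 'cV[R]_m) :
    set ('cV[R]_n * (I -> 'cV[R]_n)) :=
  [set p | p.1 != 0 /\
     forall i, (argmin (dot p.1) (polyhedron (A i) (b i))
                `&` extreme_points (polyhedron (A i) (b i))) (p.2 i)].

Definition loss (R : realType) (n : nat) (N : 'cV[R]_n -> R)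
    (I : finType) (J : I -> finType) (x : forall i, J i -> 'cV[R]_n)
    (p : 'cV[R]_n * (I -> 'cV[R]_n)) : R :=
  \sum_(i : I) \sum_(j : J i) N (x i j - p.2 i).

Definition loss_optimal (R : realType) (m n : nat) (N : 'cV[R]_n -> R)
    (I : finType) (J : I -> finType)
    (A : I -> 'M[R]_(m, n)) (b : I -> 'cV[R]_m)
    (x : forall i, J i -> 'cV[R]_n) : set ('cV[R]_n * (I -> 'cV[R]_n)) :=
  argmin (loss N x) (feasible A b).

Definition Chat' (R : realType) (m n : nat) (N : 'cV[R]_n -> R)
    (I : finType) (J : I -> finType)
    (A : I -> 'M[R]_(m, n)) (b : I -> 'cV[R]_m)
    (x : forall i, J i -> 'cV[R]_n) : set 'cV[R]_n :=
  [set c | exists xhat, loss_optimal N A b x (c, xhat)].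

Definition Chat (R : realType) (m n : nat) (N : 'cV[R]_n -> R)
    (I : finType) (J : I -> finType)
    (A : I -> 'M[R]_(m, n)) (b : I -> 'cV[R]_m)
    (x : forall i, J i -> 'cV[R]_n) : set 'cV[R]_n :=
  Chat' N A b x `|` [set 0].

(* Main.v *)
Require Import Defs.
From HB Require Import structures.
From mathcomp Require Import all_boot all_order all_algebra.
From mathcomp Require Import all_classical all_reals all_analysis.
From mathcomp Require Import ring lra.
Import Order.TTheory GRing.Theory Num.Theory.
Import numFieldNormedType.Exports.
Local Open Scope classical_set_scope.
Local Open Scope ring_scope.

(** Write [xh] for the unique optimal tuple of decisions.  The loss depends on
    the decisions only, so as soon as one optimal solution has the decisions
    [xh], every feasible pair [(c, xh)] is optimal too.  By uniqueness the
    decisions of every optimal pair are [xh], hence [Chat] is exactly the set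
    of all [c] -- zero included -- for which each [xh i] minimizes [dot c]
    over the [i]-th polyhedron ([Chat_eq_optimal_costs]). This set is cut out
    by the linear inequalities [dot c (xh i) <= dot c y], so it is a closed
    convex cone, and the claim is the projection theorem for closed convex
    sets: a nearest point exists by compactness ([exists_nearest]), and two
    nearest points coincide since otherwise, by the parallelogram law, their
    midpoint would be strictly nearer ([nearest_unique]). *)

Lemma sqnorm2_ge0 {R : realType} {n : nat} (v : 'cV[R]_n) : 0 <= sqnorm2 v.
Proof. by apply: sumr_ge0 => k _; exact: sqr_ge0. Qed.

Lemma sqnorm2_le0 {R : realType} {n : nat} (v : 'cV[R]_n) :
  sqnorm2 v <= 0 -> v = 0.
Proof.
move=> v_le0; have /eqP : sqnorm2 v = 0.
  by apply/eqP; rewrite eq_le v_le0 sqnorm2_ge0.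
rewrite psumr_eq0 => [/allP v0|k _]; last exact: sqr_ge0.
apply/colP => k; rewrite mxE; apply/eqP.
by rewrite -sqrf_eq0; apply: v0; rewrite mem_index_enum.
Qed.

Lemma sqr_coord_le_sqnorm2 {R : realType} {n : nat} (v : 'cV[R]_n) (k : 'I_n) :
  (v k 0) ^+ 2 <= sqnorm2 v.
Proof.
by rewrite /sqnorm2 (bigD1 k) //= lerDl sumr_ge0 // => j _; exact: sqr_ge0.
Qed.

(** The parallelogram law for [a - p] and [a - q]. *)
Lemma sqnorm2_midpoint {R : realType} {n : nat} (a p q : 'cV[R]_n) :
  sqnorm2 (a - 2^-1 *: (p + q)) =
  2^-1 * (sqnorm2 (a - p) + sqnorm2 (a - q)) - 4^-1 * sqnorm2 (p - q).
Proof.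
rewrite /sqnorm2 -big_split !mulr_sumr -sumrB; apply: eq_bigr => k _ /=.
by rewrite !mxE; field.
Qed.

Lemma dotE {R : realType} {n : nat} (u v : 'cV[R]_n) :
  dot u v = \sum_k u k 0 * v k 0.
Proof. by rewrite /dot mxE; apply: eq_bigr => k _; rewrite mxE. Qed.

Lemma dotDl {R : realType} {n : nat} (u w v : 'cV[R]_n) :
  dot (u + w) v = dot u v + dot w v.
Proof. by rewrite /dot linearD mulmxDl mxE. Qed.

Lemma dotZl {R : realType} {n : nat} (a : R) (u v : 'cV[R]_n) :
  dot (a *: u) v = a * dot u v.
Proof. by rewrite /dot linearZ -scalemxAl mxE. Qed.

Lemma continuous_sum {R : realType} {T : topologicalType} {n : nat}
    (f : 'I_n -> T -> R) :
  (forall k, continuous (f k)) -> continuous (fun u => \sum_k f k u).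
Proof.
have -> : (fun u => \sum_k f k u) = \sum_k f k.
  by apply/funext => u; rewrite fct_sumE.
move=> f_cont; elim/big_ind : _ => [u|g h g_cont h_cont u|k _].
- exact: cvg_cst.
- by apply: continuousD; [exact: g_cont|exact: h_cont].
- exact: f_cont.
Qed.

Lemma continuous_dotl {R : realType} {n : nat} (v : 'cV[R]_n) :
  continuous (fun u : 'cV[R]_n => dot u v).
Proof.
have -> : (fun u : 'cV[R]_n => dot u v) = fun u => \sum_k u k 0 * v k 0.
  by apply/funext => u; exact: dotE.
apply: continuous_sum => k u.
by apply: continuousM; [exact: coord_continuous|exact: cst_continuous].
Qed.

Lemma continuous_sqdist {R : realType} {n : nat} (a : 'cV[R]_n) :
  continuous (fun c : 'cV[R]_n => sqnorm2 (a - c)).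
Proof.
have -> : (fun c : 'cV[R]_n => sqnorm2 (a - c)) =
    fun c => \sum_k (a k 0 - c k 0) * (a k 0 - c k 0).
  by apply/funext => c; apply: eq_bigr => k _; rewrite !mxE expr2.
apply: continuous_sum => k c.
have diff_cont : {for c, continuous (fun c : 'cV[R]_n => a k 0 - c k 0)}.
  by apply: continuousB; [exact: cst_continuous|exact: coord_continuous].
exact: (continuousM diff_cont diff_cont).
Qed.

Lemma trmx_continuous {T : topologicalType} {m n : nat} :
  continuous (@trmx T m n).
Proof.
move=> M B [P nbhsP sPB]; exists (fun i j => P j i).
  by move=> i j; have := nbhsP j i; rewrite mxE.
by move=> M' PM'; apply: sPB => i j; rewrite mxE; exact: PM'.
Qed.

(** Tychonoff for row vectors, transported along the transposition. *)
Lemma cV_compact {T : ptopologicalType} {n : nat} (B : 'I_n -> set T) :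
  (forall k, compact (B k)) ->
  compact [set v : 'cV[T]_n | forall k, B k (v k ord0)].
Proof.
move=> /rV_compact Bco.
rewrite (_ : mkset _ =
  trmx @` [set v : 'rV[T]_n | forall k, B k (v ord0 k)]).
  apply: continuous_compact => //.
  by apply: continuous_subspaceT; exact: trmx_continuous.
apply/seteqP; split=> [v Bv|_ [v Bv <-] k]; last by rewrite mxE; exact: Bv.
by exists v^T => [k|]; rewrite ?trmxK // mxE; exact: Bv.
Qed.

(** Only the points at least as near to [a] as a given point of [C] compete,
    and these lie in a compact box around [a]. *)
Lemma exists_nearest {R : realType} {n : nat} (C : set 'cV[R]_n)
    (a : 'cV[R]_n) :
  closed C -> C !=set0 -> argmin (fun c => sqnorm2 (a - c)) C !=set0.
Proof.
move=> Ccl [c0 Cc0]; set r := Num.sqrt (sqnorm2 (a - c0)).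
pose box := [set v : 'cV[R]_n | forall k,
  `[a k 0 - r, a k 0 + r]%classic (v k ord0)].
have in_box c : sqnorm2 (a - c) <= sqnorm2 (a - c0) -> box c.
  move=> c_near k /=; rewrite in_itv /= -ler_distl distrC.
  rewrite -sqrtr_sqr; apply: ler_wsqrtr; apply: le_trans c_near.
  by have := sqr_coord_le_sqnorm2 (a - c) k; rewrite !mxE.
have box_compact : compact (C `&` box).
  rewrite setIC; apply: compact_closedI => //.
  apply: (@cV_compact _ _ (fun k => `[a k 0 - r, a k 0 + r]%classic)) => k.
  exact: segment_compact.
have Cbox0 : C `&` box !=set0 by exists c0; split => //; exact: in_box.
have [c] := compact_EVT_min Cbox0 box_compact
  (continuous_subspaceT (continuous_sqdist a)).
rewrite inE => -[Cc _] c_min; exists c; split=> // y Cy.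
have [y_near|y_far] := leP (sqnorm2 (a - y)) (sqnorm2 (a - c0)).
  by apply: c_min; rewrite inE; split => //; exact: in_box.
apply: le_trans (ltW y_far); apply: c_min; rewrite inE.
by split => //; exact: in_box.
Qed.

(** The midpoint of [p] and [q] is no nearer to [a] than [p] and [q] are, so the
    defect [4^-1 * sqnorm2 (p - q)] in the parallelogram law must vanish. *)
Lemma nearest_unique {R : realType} {n : nat} {C : set 'cV[R]_n}
    {a p q : 'cV[R]_n} :
  (forall u v, C u -> C v -> C (2^-1 *: (u + v))) ->
  argmin (fun c => sqnorm2 (a - c)) C p ->
  argmin (fun c => sqnorm2 (a - c)) C q -> p = q.
Proof.
move=> Cmid [Cp p_min] [Cq q_min]; apply/eqP; rewrite -subr_eq0; apply/eqP.
apply: sqnorm2_le0; have := sqnorm2_midpoint a p q.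
have := p_min _ (Cmid _ _ Cp Cq); have := q_min _ (Cmid _ _ Cp Cq); lra.
Qed.

Definition optimal_costs {R : realType} {n : nat} {I : Type}
    (P : I -> set 'cV[R]_n) (xh : I -> 'cV[R]_n) : set 'cV[R]_n :=
  [set c | forall i y, P i y -> dot c (xh i) <= dot c y].

Lemma optimal_costs_closed {R : realType} {n : nat} {I : Type}
    (P : I -> set 'cV[R]_n) (xh : I -> 'cV[R]_n) : closed (optimal_costs P xh).
Proof.
rewrite (_ : optimal_costs P xh = \bigcap_(iy in [set iy | P iy.1 iy.2])
    [set c | 0 <= dot c iy.2 - dot c (xh iy.1)]).
  apply: closed_bigI => -[i y] _ /=.
  apply: (@closed_comp _ _ (fun c => dot c y - dot c (xh i)) [set t | 0 <= t]).
    move=> c _.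
    exact: (continuousB (continuous_dotl _ c) (continuous_dotl _ c)).
  exact: closed_ge.
apply/seteqP; split=> [c c_opt [i y] Piy|c c_opt i y Piy] /=.
  by rewrite subr_ge0; exact: c_opt.
by rewrite -subr_ge0; exact: (c_opt (i, y)).
Qed.

Lemma optimal_costs_midpoint {R : realType} {n : nat} {I : Type}
    (P : I -> set 'cV[R]_n) (xh : I -> 'cV[R]_n) {u v : 'cV[R]_n} :
  optimal_costs P xh u -> optimal_costs P xh v ->
  optimal_costs P xh (2^-1 *: (u + v)).
Proof.
move=> u_opt v_opt i y Piy; rewrite !dotZl !dotDl.
by apply: ler_wpM2l; rewrite ?invr_ge0 // lerD // ?u_opt ?v_opt.
Qed.

(** The optimal pair [(c0, xh)] provides the extremality of the [xh i] and the
    optimality of their loss; both are properties of [xh] alone, so replacing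
    [c0] by any nonzero vector of the cone keeps them. *)
Lemma Chat_eq_optimal_costs {R : realType} {m n : nat} {N : 'cV[R]_n -> R}
    {I : finType} {J : I -> finType}
    {A : I -> 'M[R]_(m, n)} {b : I -> 'cV[R]_m}
    {x : forall i : I, J i -> 'cV[R]_n}
    {c0 : 'cV[R]_n} {xh : I -> 'cV[R]_n} :
  loss_optimal N A b x (c0, xh) ->
  (forall c xh', loss_optimal N A b x (c, xh') -> xh = xh') ->
  Chat N A b x = optimal_costs (fun i => polyhedron (A i) (b i)) xh.
Proof.
move=> [[_ xh_feas] xh_min] xh_uniq; apply/seteqP; split=> c.
  case=> [[xh' c_opt]|-> i y _]; last by rewrite /dot trmx0 !mul0mx.
  have xhE := xh_uniq _ _ c_opt; move: c_opt; rewrite -xhE => -[[_ c_feas] _].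
  by move=> i; have [[_ c_min] _] := c_feas i.
move=> c_cone; have [->|c_neq0] := eqVneq c 0; first by right.
left; exists xh; split; last exact: xh_min.
split=> // i; have [[Pxh _] xh_ext] := xh_feas i.
by split=> //; split=> // y; exact: c_cone.
Qed.

Theorem corollary1 (R : realType) (m n : nat) (n_ge1 : (1 <= n)%N)
    (I : finType) (J : I -> finType)
    (A : I -> 'M[R]_(m, n)) (b : I -> 'cV[R]_m)
    (x : forall i : I, J i -> 'cV[R]_n)
    (N : 'cV[R]_n -> R) (N_norm : is_norm N)
    (P_compact : forall i : I, compact (polyhedron (A i) (b i)))
    (P_nonempty : forall i : I, polyhedron (A i) (b i) !=set0)
    (xhat_unique : exists! xhat : I -> 'cV[R]_n,
        exists chat : 'cV[R]_n, loss_optimal N A b x (chat, xhat)) :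
  forall cbar : 'cV[R]_n,
    exists! chat : 'cV[R]_n,
      argmin (fun c => sqnorm2 (cbar - c)) (Chat N A b x) chat.
Proof.
move=> cbar; have [xh [[c0 c0_opt] xh_uniq]] := xhat_unique.
have ChatE := Chat_eq_optimal_costs c0_opt
  (fun c xh' c_opt => xh_uniq xh' (ex_intro _ c c_opt)).
have Chat0 : Chat N A b x !=set0 by exists 0; right.
move: Chat0; rewrite ChatE => Chat0.
have [c c_near] := exists_nearest _ cbar (optimal_costs_closed _ _) Chat0.
exists c; split=> // c'; apply: nearest_unique c_near.
move=> u v; exact: optimal_costs_midpoint.
Qed.
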